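(* For every ordinal $\alpha\ge\omega$ the following hold. (i) There exist $\mathfrak A\in\mathbf{RQEA}_\alpha$ and $\mathfrak B\in\mathbf{QEA}_{\alpha+\omega}$ such that $\mathfrak A\subseteq\mathfrak{Nr}_\alpha\mathfrak B$ and $A$ generates $\mathfrak B$, but $\mathfrak A\ne\mathfrak{Nr}_\alpha\mathfrak B$. (ii) There exist $\mathfrak A\in\mathbf{RQEA}_\alpha$, $\mathfrak B\in\mathbf{QEA}_{\alpha+\omega}$ and an ideal $J$ of $\mathfrak B$ such that $\mathfrak A\subseteq\mathfrak{Nr}_\alpha\mathfrak B$ and $A$ generates $\mathfrak B$, but $\mathfrak{Ig}^{\mathfrak B}(J\cap A)\ne J$. (iii) There exist $\mathfrak A,\mathfrak A'\in\mathbf{RQEA}_\alpha$, $\mathfrak B,\mathfrak B'\in\mathbf{QEA}_{\alpha+\omega}$, embeddings $e_A:\mathfrak A\to\mathfrak{Nr}_\alpha\mathfrak B$ and $e_{A'}:\mathfrak A'\to\mathfrak{Nr}_\alpha\mathfrak B'$ such that $\mathfrak{Sg}^{\mathfrak B}e_A(A)=\mathfrak B$ and $\mathfrak{Sg}^{\mathfrak B'}e_{A'}(A')=\mathfrak B'$, and an isomorphism $i:\mathfrak A\to\mathfrak A'$, for which there is no isomorphism $\bar i:\mathfrak B\to\mathfrak B'$ such that $\bar i\circ e_A=e_{A'}\circ i$.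
   Context: $\mathbf{QEA}_\beta$ is the variety of quasi-polyadic equality algebras of dimension $\beta$ (in the finitary Sain–Thompson presentation): algebras $(A,+,\cdot,-,0,1,\mathsf c_i,\mathsf s^i_j,\mathsf p_{ij},\mathsf d_{ij})_{i,j<\beta}$ with Boolean reduct such that for all $i,j,k<\beta$: $\mathsf s^i_i=\mathsf p_{ii}=$ identity, $\mathsf p_{ij}=\mathsf p_{ji}$; $x\le\mathsf c_ix$; $\mathsf c_i(x+y)=\mathsf c_ix+\mathsf c_iy$; $\mathsf s^i_j\mathsf c_ix=\mathsf c_ix$; $\mathsf c_i\mathsf s^i_jx=\mathsf s^i_jx$ ($i\ne j$); $\mathsf s^i_j\mathsf c_kx=\mathsf c_k\mathsf s^i_jx$ ($k\notin\{i,j\}$); $\mathsf s^i_j,\mathsf p_{ij}$ are Boolean endomorphisms; $\mathsf p_{ij}\mathsf p_{ij}x=x$; $\mathsf p_{ij}\mathsf p_{ik}x=\mathsf p_{jk}\mathsf p_{ij}x$ ($i,j,k$ distinct); $\mathsf p_{ij}\mathsf s^j_ix=\mathsf s^i_jx$; $\mathsf s^i_j\mathsf d_{ij}=1$; $x\cdot\mathsf d_{ij}\le\mathsf s^i_jx$. $\mathbf{RQEA}_\alpha$ is the class of representable ones: algebras isomorphic to subdirect products of subalgebras of full set algebras with universe $\wp({}^\alpha U)$, Boolean set operations, $\mathsf c_iX=\{s:\exists z\in X\ \forall j\ne i\ s_j=z_j\}$, $\mathsf d_{ij}=\{s:s_i=s_j\}$, $\mathsf p_{ij}X=\{s:s\circ[i,j]\in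 X\}$, $\mathsf s^i_jX=\{s:s\circ[i|j]\in X\}$ ($[i,j]$ the transposition, $[i|j]$ the replacement sending $i$ to $j$ and fixing all else). For $\alpha<\beta$ and $\mathfrak B\in\mathbf{QEA}_\beta$, $\mathfrak{Nr}_\alpha\mathfrak B$ is the algebra in $\mathbf{QEA}_\alpha$ with universe $\{x\in B:\mathsf c_ix=x\text{ for all }i\in\beta\setminus\alpha\}$ and the operations of $\mathfrak B$ with indices in $\alpha$. $\mathfrak{Sg}^{\mathfrak B}X$ and $\mathfrak{Ig}^{\mathfrak B}X$ are the subalgebra and the ideal generated by $X$ in $\mathfrak B$. Ideals are those corresponding to congruences: Boolean ideals closed under all $\mathsf c_i$ (and hence under the substitution operations). *)

(* Defs.v *)
From mathcomp Require Import all_boot.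
From mathcomp Require Import boolp classical_sets wochoice.

Set Implicit Arguments.
Unset Strict Implicit.
Unset Printing Implicit Defensive.

Local Open Scope classical_set_scope.

(* An ordinal is represented by a well-ordered type; algebras of dimension alpha
   only see its underlying set of indices. *)

Record Ord := MkOrd {
  ord_type :> eqType;
  ord_rel : rel ord_type;
  ord_wo : well_order ord_rel }.

(* [alpha] is isomorphic to an initial segment of [beta]. *)
Definition ord_le (alpha beta : Ord) : Prop :=
  exists f : alpha -> beta,
    {mono f : x y / ord_rel x y} /\
    forall x y, ord_rel y (f x) -> exists z, f z = y.

Lemma leq_wo : well_order leq.
Proof.
apply: antisymmetric_well_order; first exact: anti_leq.
move=> A [n nA]; exists (ex_minn (ex_intro _ n nA : exists n, n \in A)).
by case: ex_minnP => m mA m_min; split.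
Qed.

Definition omega : Ord := MkOrd leq_wo.

Section OrdinalSum.
Variables alpha beta : Ord.

Definition sum_rel (x y : alpha + beta) : bool :=
  match x, y with
  | inl a, inl b => ord_rel a b
  | inl _, inr _ => true
  | inr _, inl _ => false
  | inr a, inr b => ord_rel a b
  end.

Lemma sum_wo : well_order sum_rel.
Proof.
move=> A [x xA].
have [[a aA]|noA] := pselect (exists a, inl a \in A).
  have [|m [[mA m_min] m_uniq]] := @ord_wo alpha [pred b | inl b \in A].
    by exists a.
  exists (inl m); split; first by split=> // -[b|b] bA //=; apply: m_min.
  move=> [b|b] [bA b_min]; last by have := b_min _ mA.
  by congr inl; apply: m_uniq; split=> // y yA; apply: b_min (inl y) yA.
have [|m [[mA m_min] m_uniq]] := @ord_wo beta [pred b | inr b \in A].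
  by case: x xA => b bA; [case: noA; exists b | exists b].
exists (inr m); split.
  by split=> // -[b|b] bA /=; [case: noA; exists b | apply: m_min].
move=> [b|b] [bA b_min]; first by case: noA; exists b.
by congr inr; apply: m_uniq; split=> // y yA; apply: b_min (inr y) yA.
Qed.

Definition ord_add : Ord := MkOrd sum_wo.
End OrdinalSum.

Declare Scope qea_scope.
Delimit Scope qea_scope with qea.

Record algebra (I : Type) := Algebra {
  carrier :> Type;
  aadd : carrier -> carrier -> carrier;
  amul : carrier -> carrier -> carrier;
  aopp : carrier -> carrier;
  azero : carrier;
  aone : carrier;
  cyl : I -> carrier -> carrier;
  sub : I -> I -> carrier -> carrier; (* [sub i j] is s^i_j *)
  swp : I -> I -> carrier -> carrier;
  diag : I -> I -> carrier }.

Arguments azero {I a}.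
Arguments aone {I a}.
Arguments diag {I} a _ _.
Notation "x + y" := (aadd x y) : qea_scope.
Notation "x * y" := (amul x y) : qea_scope.
Notation "- x" := (aopp x) : qea_scope.
Notation "0" := azero : qea_scope.
Notation "1" := aone : qea_scope.
Notation "x <= y" := (aadd x y = y) : qea_scope.
Local Open Scope qea_scope.

(* Complemented distributive lattices; the bounds 0 and 1 are pinned down by the
   complement laws. *)
Record is_boolean (I : Type) (A : algebra I) : Prop := IsBoolean {
  baddA : associative (@aadd I A);
  baddC : commutative (@aadd I A);
  bmulA : associative (@amul I A);
  bmulC : commutative (@amul I A);
  baddK : forall x y : A, x + x * y = x;
  bmulK : forall x y : A, x * (x + y) = x;
  bmulDl : left_distributive (@amul I A) (@aadd I A);
  baddxN : forall x : A, x + - x = 1;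
  bmulxN : forall x : A, x * - x = 0 }.

Record is_bool_endo (I : Type) (A : algebra I) (f : A -> A) : Prop :=
  IsBoolEndo {
  endo_add : {morph f : x y / x + y};
  endo_mul : {morph f : x y / x * y};
  endo_opp : {morph f : x / - x};
  endo_zero : f 0 = 0;
  endo_one : f 1 = 1 }.

Record is_QEA (I : Type) (A : algebra I) : Prop := IsQEA {
  qea_boolean : is_boolean A;
  sub_id : forall i (x : A), sub i i x = x;
  swp_id : forall i (x : A), swp i i x = x;
  swpC : forall i j (x : A), swp i j x = swp j i x;
  cyl_ext : forall i (x : A), x <= cyl i x;
  cylD : forall i (x y : A), cyl i (x + y) = cyl i x + cyl i y;
  sub_cyl : forall i j (x : A), sub i j (cyl i x) = cyl i x;
  cyl_sub : forall i j (x : A), i <> j -> cyl i (sub i j x) = sub i j x;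
  sub_cylC : forall i j k (x : A), k <> i -> k <> j ->
    sub i j (cyl k x) = cyl k (sub i j x);
  sub_endo : forall i j, is_bool_endo (@sub I A i j);
  swp_endo : forall i j, is_bool_endo (@swp I A i j);
  swpK : forall i j (x : A), swp i j (swp i j x) = x;
  swp_swp : forall i j k (x : A), i <> j -> i <> k -> j <> k ->
    swp i j (swp i k x) = swp j k (swp i j x);
  swp_sub : forall i j (x : A), swp i j (sub j i x) = sub i j x;
  sub_diag : forall i j, sub i j (diag A i j) = 1;
  diag_sub : forall i j (x : A), x * diag A i j <= sub i j x }.

Record QEA (I : Type) := MkQEA {
  QEA_algebra :> algebra I;
  QEA_axioms : is_QEA QEA_algebra }.

Record is_hom (I : Type) (A B : algebra I) (f : A -> B) : Prop := IsHom {
  hom_add : {morph f : x y / x + y};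
  hom_mul : {morph f : x y / x * y};
  hom_opp : {morph f : x / - x};
  hom_zero : f 0 = 0;
  hom_one : f 1 = 1;
  hom_cyl : forall i, {morph f : x / cyl i x};
  hom_sub : forall i j, {morph f : x / sub i j x};
  hom_swp : forall i j, {morph f : x / swp i j x};
  hom_diag : forall i j, f (diag A i j) = diag B i j }.

Definition is_embedding (I : Type) (A B : algebra I) (f : A -> B) : Prop :=
  is_hom f /\ injective f.

Definition is_iso (I : Type) (A B : algebra I) (f : A -> B) : Prop :=
  is_hom f /\ bijective f.

Definition isomorphic (I : Type) (A B : algebra I) : Prop :=
  exists f : A -> B, is_iso f.

Record is_subuniverse (I : Type) (A : algebra I) (S : set A) : Prop :=
  IsSubuniverse {
  clo_add : forall x y, S x -> S y -> S (x + y);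
  clo_mul : forall x y, S x -> S y -> S (x * y);
  clo_opp : forall x, S x -> S (- x);
  clo_zero : S 0;
  clo_one : S 1;
  clo_cyl : forall i x, S x -> S (cyl i x);
  clo_sub : forall i j x, S x -> S (sub i j x);
  clo_swp : forall i j x, S x -> S (swp i j x);
  clo_diag : forall i j, S (diag A i j) }.

Record subalgebra (I : Type) (A : algebra I) := Subalgebra {
  universe :> set A;
  universe_closed : is_subuniverse universe }.

Definition alg_of (I : Type) (A : algebra I) (S : subalgebra A) : algebra I :=
  let C := universe_closed S in
  {| carrier := {x : A | universe S x};
     aadd x y := exist _ _ (clo_add C (svalP x) (svalP y));
     amul x y := exist _ _ (clo_mul C (svalP x) (svalP y));
     aopp x := exist _ _ (clo_opp C (svalP x));
     azero := exist _ _ (clo_zero C);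
     aone := exist _ _ (clo_one C);
     cyl i x := exist _ _ (clo_cyl C i (svalP x));
     sub i j x := exist _ _ (clo_sub C i j (svalP x));
     swp i j x := exist _ _ (clo_swp C i j (svalP x));
     diag i j := exist _ _ (clo_diag C i j) |}.

Definition prod_alg (I K : Type) (A : K -> algebra I) : algebra I :=
  {| carrier := forall k, A k;
     aadd x y := fun k => x k + y k;
     amul x y := fun k => x k * y k;
     aopp x := fun k => - x k;
     azero := fun k => 0;
     aone := fun k => 1;
     cyl i x := fun k => cyl i (x k);
     sub i j x := fun k => sub i j (x k);
     swp i j x := fun k => swp i j (x k);
     diag i j := fun k => diag (A k) i j |}.

Definition is_subdirect (I K : Type) (A : K -> algebra I)
    (P : subalgebra (prod_alg A)) : Prop :=
  forall k (y : A k), exists2 x, universe P x & x k = y.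

Definition Sg (I : Type) (B : algebra I) (X : set B) : set B :=
  smallest (@is_subuniverse I B) X.

(* Closure under substitutions follows from [ideal_cyl] and [ideal_le]. *)
Record is_ideal (I : Type) (B : algebra I) (J : set B) : Prop := IsIdeal {
  ideal0 : J 0;
  idealD : forall x y, J x -> J y -> J (x + y);
  ideal_le : forall x y : B, x <= y -> J y -> J x;
  ideal_cyl : forall i x, J x -> J (cyl i x) }.

Definition Ig (I : Type) (B : algebra I) (X : set B) : set B :=
  smallest (@is_ideal I B) X.

Arguments is_hom {I} A B f.
Arguments is_embedding {I} A B f.
Arguments is_iso {I} A B f.
Arguments Sg {I} B X _.
Arguments is_ideal {I} B J.
Arguments Ig {I} B X _.

(* [transposition i j] is [i,j]; [replacement i j] is [i|j]. *)
Definition transposition (I : eqType) (i j k : I) : I :=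
  if k == i then j else if k == j then i else k.

Definition replacement (I : eqType) (i j k : I) : I :=
  if k == i then j else k.

Definition full_set_alg (I : eqType) (U : Type) : algebra I :=
  {| carrier := set (I -> U);
     aadd X Y := X `|` Y;
     amul X Y := X `&` Y;
     aopp X := ~` X;
     azero := set0;
     aone := setT;
     cyl i X := [set s | exists2 z, X z & forall j, j <> i -> s j = z j];
     sub i j X := [set s : I -> U | X (s \o replacement i j)];
     swp i j X := [set s : I -> U | X (s \o transposition i j)];
     diag i j := [set s : I -> U | s i = s j] |}.

Definition RQEA (I : eqType) (A : algebra I) : Prop :=
  exists (K : Type) (U : K -> Type)
    (S : forall k, subalgebra (full_set_alg I (U k)))
    (P : subalgebra (prod_alg (fun k => alg_of (S k)))),
    is_subdirect P /\ isomorphic A (alg_of P).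

Definition reduct (I J : Type) (f : I -> J) (B : algebra J) : algebra I :=
  {| carrier := B;
     aadd := @aadd J B;
     amul := @amul J B;
     aopp := @aopp J B;
     azero := 0;
     aone := 1;
     cyl i := cyl (f i);
     sub i j := sub (f i) (f j);
     swp i j := swp (f i) (f j);
     diag i j := diag B (f i) (f j) |}.

Section NeatReduct.
Variables (alpha : Ord) (B : QEA (ord_add alpha omega)).

(* The indices of [ord_add alpha omega] below [alpha] are the [inl i]. *)
(* [Nr] below is a subuniverse of [Rd], so that "A is a subalgebra of the neat
   reduct of B" is rendered by [A : subalgebra (Rd B)] together with the inclusion
   of [A] in [Nr B]; all sets involved are then subsets of the carrier of [B]. *)
Definition Rd : algebra alpha := reduct (inl : alpha -> ord_add alpha omega) B.

Definition Nr_universe : set B :=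
  [set x | forall k : omega, cyl (inr k : ord_add alpha omega) x = x].

Let ax := QEA_axioms B.
Let bax := qea_boolean ax.
Let spare (k : nat) : ord_add alpha omega := inr k.

Lemma Nr_fixE (k : nat) (x : B) :
  (cyl (spare k) x = x) <-> (sub (spare k) (spare k.+1) x = x).
Proof.
have neq : spare k <> spare k.+1 by case=> /n_Sn.
by split=> e; [rewrite -{1}e sub_cyl | rewrite -e cyl_sub].
Qed.

Lemma Nr_bool (x : B) :
  (forall k, sub (spare k) (spare k.+1) x = x) -> Nr_universe x.
Proof. by move=> e k; apply/Nr_fixE. Qed.

Lemma Nr_sub (x : B) k :
  Nr_universe x -> sub (spare k) (spare k.+1) x = x.
Proof. by move=> Nx; apply/Nr_fixE/Nx. Qed.

Lemma Nr_opp (x : B) : Nr_universe x -> Nr_universe (- x).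
Proof.
move=> Nx; apply: Nr_bool => k.
by rewrite (endo_opp (sub_endo ax _ _)) Nr_sub.
Qed.

Lemma badd0 (x : B) : x + 0 = x.
Proof. by rewrite -(bmulxN bax x) (baddK bax). Qed.

Lemma bmul1 (x : B) : x * 1 = x.
Proof. by rewrite -(baddxN bax x) (bmulK bax). Qed.

Lemma ble_anti (x y : B) : x <= y -> y <= x -> x = y.
Proof. by move=> e <-; rewrite (baddC bax) e. Qed.

Lemma bNK (x : B) : - - x = x.
Proof.
have ble (y z w : B) : y + z = 1 -> y * w = 0 -> w <= z.
  move=> s ew; rewrite -[w]bmul1 (bmulC bax) -s (bmulDl bax) ew.
  by rewrite (baddC bax 0) badd0 (baddC bax) (baddK bax).
apply: ble_anti; apply: (ble (- x)).
- by rewrite (baddC bax) (baddxN bax).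
- exact: bmulxN.
- exact: baddxN.
- by rewrite (bmulC bax) (bmulxN bax).
Qed.

Lemma Nr_diag (i j : alpha) : Nr_universe (diag B (inl i) (inl j)).
Proof.
set d := diag B _ _; rewrite -[d]bNK; apply: Nr_opp => k.
set c := cyl _ (- d).
have c0 : cyl (spare k) 0 = 0 :> B.
  by apply/Nr_fixE; rewrite (endo_zero (sub_endo ax _ _)).
have e : sub (inl i) (inl j) c = 0 :> B.
  rewrite sub_cylC // (endo_opp (sub_endo ax _ _)) sub_diag //.
  have -> : aopp 1 = 0 :> B by rewrite -(bmulxN bax 1) (bmulC bax) bmul1.
  exact: c0.
have cd : c * d = 0.
  by have := diag_sub ax (inl i) (inl j) c; rewrite e badd0.
apply: ble_anti; last exact: cyl_ext.
rewrite -/c -{1}[c]bmul1 -(baddxN bax d) (bmulC bax) (bmulDl bax).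
rewrite (bmulC bax d) cd (baddC bax 0) badd0.
by rewrite (baddC bax) (baddK bax).
Qed.

Lemma Nr_cyl (i : alpha) (x : B) :
  Nr_universe x -> Nr_universe (cyl (inl i) x).
Proof.
by move=> Nx; apply: Nr_bool => k; rewrite sub_cylC // Nr_sub.
Qed.

Lemma Nr_swp (i j : alpha) (x : B) :
  Nr_universe x -> Nr_universe (swp (inl i) (inl j) x).
Proof.
move=> Nx k; have [->|/eqP neq] := eqVneq i j; first by rewrite swp_id.
have nIJ : inl i <> inl j :> ord_add alpha omega by case.
set I : ord_add alpha omega := inl i; set J : ord_add alpha omega := inl j.
set K : ord_add alpha omega := inr k.
have move_ (p q : ord_add alpha omega) (y : B) :
    q <> p -> cyl q y = y -> cyl p (swp q p y) = swp q p y.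
  move=> qp e; rewrite (swpC ax) -e -(sub_cyl ax q p) swp_sub //.
  by rewrite cyl_sub // => /esym.
have e1 := move_ I K x (fun e => ltac:(discriminate e)) (Nx k).
have e2 := move_ J I _ nIJ e1.
have e3 := move_ K J _ (fun e => ltac:(discriminate e)) e2.
by move: e3; rewrite (swpC ax K I) (swp_swp ax) // (swpK ax).
Qed.

Lemma Nr_closed : @is_subuniverse alpha Rd Nr_universe.
Proof.
split=> /=.
- by move=> x y Nx Ny k; rewrite cylD // Nx Ny.
- move=> x y Nx Ny; apply: Nr_bool => k.
  by rewrite (endo_mul (sub_endo ax _ _)) !Nr_sub.
- exact: Nr_opp.
- by apply: Nr_bool => k; rewrite (endo_zero (sub_endo ax _ _)).
- by apply: Nr_bool => k; rewrite (endo_one (sub_endo ax _ _)).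
- exact: Nr_cyl.
- by move=> i j x Nx k; rewrite -sub_cylC // Nx.
- exact: Nr_swp.
- exact: Nr_diag.
Qed.

Definition Nr : subalgebra Rd := Subalgebra Nr_closed.

End NeatReduct.

(* Main.v *)
Require Import Defs.
From mathcomp Require Import all_boot.
From mathcomp Require Import boolp classical_sets.

(** Everything comes from the fact that the algebra [A] sees its sequences
    [alpha -> U] through [alpha] coordinates only, whereas [B] may hold one more
    value in a spare coordinate. It suffices to find one element of one algebra
    that behaves differently in two dilations.

    Take [U = alpha + nat]. For injective [s], let [F] be the set of the natural
    numbers among the values of [s]. The two relations [max_parity false] and
    [max_parity true] on sequences are symmetric in the coordinates, hold of
    injective sequences only, and are decided by [F]: the first asks that [max F]
    exist and be even, the second that it exist and be odd if [0] is in [F], even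
    if not. When [F] is bounded, replacing one coordinate by a new large number
    makes either relation true or false at will. So a player who sees one
    sequence at a time, and changes one coordinate at a time, cannot tell the
    relations apart: [bisim] is a back-and-forth system ([bisim_zigzag]). Hence
    the pairs [(X, X')] of sets that agree along [bisim] form a subalgebra [A] of
    the square of the full set algebra, the pair of the two relations belongs to
    it, and both projections are injective on [A] ([component_embedding]), so
    that [A] is representable in two ways.

    With a spare coordinate holding a further value [u], the relations come apart.
    Among the sets obtained from the values of [s] and [u] by leaving out one
    element, only the omission of the greatest number can change the maximum. So
    it is impossible that [max_parity false] holds when [u] or [s i0] is left out
    and fails when [s i1] or [s i2] is ([exchange_set_max_eq0]). For
    [max_parity true] this happens: the omission of [0] also matters
    ([exchange_set_flagged_max_neq0]). The term [exchange] expresses this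
    situation with one spare index.

    Each projection of [A], followed by cylindrification to dimension
    [alpha + omega], generates a dilation of [A]. The term vanishes at the pair of
    relations in the first dilation and not in the second, so no isomorphism
    between them is the identity on [A]. For the other two claims, embed [A] by
    both projections at once into a square, and let [B] be generated by its image.
    There the term takes a value [y = (0, y1)] with [y1 <> 0]. It lies in the
    neat reduct, but not in [A], since the first projection is injective on [A].
    The kernel [J] of the first projection of [B] contains [y] but meets [A] in
    [0] only, so it is not generated by its trace on [A]. *)

Set Implicit Arguments.
Unset Strict Implicit.
Unset Printing Implicit Defensive.

Local Open Scope classical_set_scope.

(** * Homomorphisms, subalgebras and products *)

Section Algebras.
Local Open Scope qea_scope.

Lemma comp_hom (I : Type) (A B C : algebra I) (f : A -> B) (g : B -> C) :
  is_hom A B f -> is_hom B C g -> is_hom A C (g \o f).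
Proof.
by move=> [fD fM fN f0 f1 fc fs fp fd] [gD gM gN g0 g1 gc gs gp gd]; split;
  repeat intro; rewrite /= ?(fD, fM, fN, f0, f1, fc, fs, fp, fd)
  ?(gc, gs, gp).
Qed.

Lemma comp_embedding (I : Type) (A B C : algebra I) (f : A -> B) (g : B -> C) :
  is_embedding A B f -> is_embedding B C g -> is_embedding A C (g \o f).
Proof.
by move=> [fh fI] [gh gI]; split; [exact: comp_hom | exact: inj_comp].
Qed.

Lemma inverse_iso (I : Type) (A B : algebra I) (f : A -> B) (g : B -> A) :
  is_hom A B f -> cancel f g -> cancel g f -> is_iso B A g.
Proof.
move=> [fD fM fN f0 f1 fc fs fp fd] fK gK.
split; last by exists f.
by split; repeat intro; apply: (can_inj fK);
  rewrite ?(fD, fM, fN, f0, f1, fc, fs, fp, fd) !gK.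
Qed.

Lemma inj_surj_iso (I : Type) (A B : algebra I) (f : A -> B) :
  is_embedding A B f -> (forall y, exists x, f x = y) ->
  is_iso A B f /\ isomorphic B A.
Proof.
move=> [fh fI] fsurj; pose g y := sval (cid (fsurj y)).
have gK : cancel g f by move=> y; rewrite /g; case: cid.
have fK : cancel f g by move=> x; apply: fI; rewrite gK.
by split; [split=> //; exists g | exists g; apply: inverse_iso fh fK gK].
Qed.

Lemma proj_hom (I K : Type) (A : K -> algebra I) (k : K) :
  is_hom (prod_alg A) (A k) (fun x => x k).
Proof. by split. Qed.

Lemma pairing_hom (I K : Type) (A : algebra I) (B : K -> algebra I)
    (f : forall k, A -> B k) :
  (forall k, is_hom A (B k) (f k)) ->
  is_hom A (prod_alg B) (fun x k => f k x).
Proof.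
move=> fh; split; repeat intro; apply: functional_extensionality_dep => c;
  by case: (fh c) => fD fM fN f0 f1 fc fs fp fd /=;
    rewrite ?(fD, fM, fN, f0, f1, fc, fs, fp, fd).
Qed.

Lemma sval_embedding (I : Type) (A : algebra I) (S : subalgebra A) :
  is_embedding (alg_of S) A sval.
Proof. by split; [split | move=> [x xS] [y yS] /= e; apply: eq_exist]. Qed.

Lemma corestrict_embedding (I : Type) (A B : algebra I) (f : A -> B)
    (S : subalgebra B) (fS : forall x, universe S (f x)) :
  is_embedding A B f ->
  is_embedding A (alg_of S) (fun x => exist _ (f x) (fS x)).
Proof.
have [_ vI] := sval_embedding S.
move=> [[fD fM fN f0 f1 fc fs fp fd] fI]; split; last by move=> x y [] /fI.
by split; repeat intro; apply: vI;
  rewrite /= ?(fD, fM, fN, f0, f1, fc, fs, fp, fd).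
Qed.

Lemma image_closed (I : Type) (A B : algebra I) (f : A -> B) (T : set A) :
  is_hom A B f -> is_subuniverse T -> is_subuniverse (f @` T).
Proof.
move=> [fD fM fN f0 f1 fc fs fp fd] [tD tM tN t0 t1 tc ts tp td]; split.
- move=> _ _ [x Tx <-] [y Ty <-]; rewrite -fD.
  by exists (x + y) => //; apply: tD.
- move=> _ _ [x Tx <-] [y Ty <-]; rewrite -fM.
  by exists (x * y) => //; apply: tM.
- by move=> _ [x Tx <-]; rewrite -fN; exists (- x) => //; apply: tN.
- by exists 0.
- by exists 1.
- by move=> i _ [x Tx <-]; rewrite -fc; exists (cyl i x) => //; apply: tc.
- by move=> i j _ [x Tx <-]; rewrite -fs; exists (sub i j x) => //; apply: ts.
- by move=> i j _ [x Tx <-]; rewrite -fp; exists (swp i j x) => //; apply: tp.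
- by move=> i j; rewrite -fd; exists (diag A i j).
Qed.

Definition range_subalgebra (I : Type) (A B : algebra I) (f : A -> B)
    (fh : is_hom A B f) : subalgebra B :=
  Subalgebra (image_closed fh
    (IsSubuniverse (S := setT) (fun _ _ _ _ => Logic.I) (fun _ _ _ _ => Logic.I)
       (fun _ _ => Logic.I) Logic.I Logic.I (fun _ _ _ => Logic.I)
       (fun _ _ _ _ => Logic.I) (fun _ _ _ _ => Logic.I) (fun _ _ => Logic.I))).

Lemma Sg_closed (I : Type) (B : algebra I) (X : set B) :
  is_subuniverse (Sg B X).
Proof.
split.
- move=> x y Sx Sy T TX; case: (TX) => -[tD *].
  by apply: tD; [exact: Sx | exact: Sy].
- move=> x y Sx Sy T TX; case: (TX) => -[? tM *].
  by apply: tM; [exact: Sx | exact: Sy].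
- by move=> x Sx T TX; apply: clo_opp (Sx _ TX); case: TX.
- by move=> T [[]].
- by move=> T [[]].
- by move=> i x Sx T TX; apply: clo_cyl (Sx _ TX); case: TX.
- by move=> i j x Sx T TX; apply: clo_sub (Sx _ TX); case: TX.
- by move=> i j x Sx T TX; apply: clo_swp (Sx _ TX); case: TX.
- by move=> i j T [tT _]; apply: clo_diag.
Qed.

(** All the axioms are equations, or equations under conditions on the indices
    only, so they are reflected by injective homomorphisms. *)
Lemma is_QEA_embedding (I : Type) (A B : algebra I) (f : A -> B) :
  is_embedding A B f -> is_QEA B -> is_QEA A.
Proof.
move=> [[fD fM fN f0 f1 fc fs fp fd] fI] [bB ? ? pC ? ? ? ? ? sE pE ? pp ? ? ?].
pose fE := (fD, fM, fN, f0, f1, fc, fs, fp, fd).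
split.
- case: bB => aA aC mA mC aK mK mD aN mN.
  by split; repeat intro; apply: fI; rewrite !fE.
- by repeat intro; apply: fI; rewrite !fE.
- by repeat intro; apply: fI; rewrite !fE.
- by repeat intro; apply: fI; rewrite !fE.
- by repeat intro; apply: fI; rewrite !fE.
- by repeat intro; apply: fI; rewrite !fE.
- by repeat intro; apply: fI; rewrite !fE.
- by repeat intro; apply: fI; rewrite !fE; auto.
- by repeat intro; apply: fI; rewrite !fE; auto.
- move=> i j; case: (sE i j) => sa sb sc sd se.
  by split; repeat intro; apply: fI; rewrite !fE.
- move=> i j; case: (pE i j) => sa sb sc sd se.
  by split; repeat intro; apply: fI; rewrite !fE.
- by repeat intro; apply: fI; rewrite !fE.
- by repeat intro; apply: fI; rewrite !fE; auto.
- by repeat intro; apply: fI; rewrite !fE.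
- by repeat intro; apply: fI; rewrite !fE.
- by repeat intro; apply: fI; rewrite !fE.
Qed.

Lemma is_QEA_prod (I K : Type) (A : K -> algebra I) :
  (forall k, is_QEA (A k)) -> is_QEA (prod_alg A).
Proof.
move=> qA; have bA k := qea_boolean (qA k).
split.
- split; repeat intro; apply: functional_extensionality_dep => c.
  + exact: baddA.
  + exact: baddC.
  + exact: bmulA.
  + exact: bmulC.
  + exact: baddK.
  + exact: bmulK.
  + exact: bmulDl.
  + exact: baddxN.
  + exact: bmulxN.
- by repeat intro; apply: functional_extensionality_dep => c; apply: sub_id.
- by repeat intro; apply: functional_extensionality_dep => c; apply: swp_id.
- by repeat intro; apply: functional_extensionality_dep => c; apply: swpC.
- by repeat intro; apply: functional_extensionality_dep => c; apply: cyl_ext.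
- by repeat intro; apply: functional_extensionality_dep => c; apply: cylD.
- by repeat intro; apply: functional_extensionality_dep => c; apply: sub_cyl.
- by repeat intro; apply: functional_extensionality_dep => c; apply: cyl_sub.
- by repeat intro; apply: functional_extensionality_dep => c; apply: sub_cylC.
- by move=> i j; split; repeat intro; apply: functional_extensionality_dep => c;
  case: (sub_endo (qA c) i j) => eD eM eN e0 e1 /=;
  rewrite ?(eD, eM, eN, e0, e1).
- by move=> i j; split; repeat intro; apply: functional_extensionality_dep => c;
  case: (swp_endo (qA c) i j) => eD eM eN e0 e1 /=;
  rewrite ?(eD, eM, eN, e0, e1).
- by repeat intro; apply: functional_extensionality_dep => c; apply: swpK.
- by repeat intro; apply: functional_extensionality_dep => c; apply: swp_swp.
- by repeat intro; apply: functional_extensionality_dep => c; apply: swp_sub.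
- by repeat intro; apply: functional_extensionality_dep => c; apply: sub_diag.
- by repeat intro; apply: functional_extensionality_dep => c; apply: diag_sub.
Qed.

(** * Full set algebras *)

Lemma replacement_transposition_id (I : eqType) (i k : I) :
  (replacement i i k = k) * (transposition i i k = k).
Proof.
by rewrite /replacement /transposition; case: eqVneq => [->|].
Qed.

Lemma is_QEA_full (I : eqType) (U : Type) : is_QEA (full_set_alg I U).
Proof.
have setP (X Y : set (I -> U)) : (forall s, X s <-> Y s) -> X = Y.
  by move=> XY; apply/seteqP; split=> s /XY.
have compE (s : I -> U) (f g : I -> I) :
    (forall k, f k = g k) -> s \o f = s \o g.
  by move=> fg; apply: functional_extensionality_dep => k /=; rewrite fg.
have idE (s : I -> U) f : (forall k, f k = k) -> s \o f = s.
  by move=> fk; apply: functional_extensionality_dep => k /=; rewrite fk.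
have exEM (X : set (I -> U)) s : X s \/ ~ X s by exact: EM.
split=> /=.
- by split=> /=; repeat intro; apply: setP => s /=;
    try (have := exEM x s); tauto.
- by move=> i x; apply: setP => s /=; rewrite idE // => k;
    rewrite replacement_transposition_id.
- by move=> i x; apply: setP => s /=; rewrite idE // => k;
    rewrite replacement_transposition_id.
- move=> i j x; apply: setP => s /=; rewrite (compE s _ (transposition j i)) //.
  by move=> k; rewrite /transposition; case: eqVneq => // ->; case: eqVneq.
- move=> i x; apply: setP => s /=; split=> [[xs|//]|]; last by right.
  by exists s.
- move=> i x y; apply: setP => s /=; split.
    by move=> [z [xz|yz] e]; [left | right]; exists z.
  by move=> [[z xz e]|[z yz e]]; exists z => //; [left | right].
- move=> i j x; apply: setP => s /=; split=> -[z xz e]; exists z => // k ki.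
    by have := e _ ki; rewrite /= /replacement; case: eqP ki.
  by rewrite /= -e // /replacement; case: eqP ki.
- move=> i j x ij; apply: setP => s /=; split=> [[z xz e]|xs]; last by exists s.
  rewrite (_ : s \o _ = z \o replacement i j) //.
  apply: functional_extensionality_dep => k /=; apply: e.
  by rewrite /replacement; case: eqP => // _ /esym.
- move=> i j k x ki kj; apply: setP => s /=; split.
    move=> [z xz e].
    exists (fun l => if l == k then z k else s l); last first.
      by move=> l lk; case: eqP.
    rewrite (_ : _ \o _ = z) //; apply: functional_extensionality_dep => l /=.
    have [->|/eqP lk] := eqVneq l k.
      by rewrite /replacement; case: (k =P i) => // _; rewrite eqxx.
    rewrite -[RHS]e //= /replacement; case: (l =P i) => _; case: eqP => //.
    by move=> jk; case: kj.
  move=> [z xz e]; exists (z \o replacement i j) => // l lk /=; apply: e.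
  by rewrite /replacement; case: eqP => // _ jk; apply: kj.
- by move=> i j; split; repeat intro; apply: setP.
- by move=> i j; split; repeat intro; apply: setP.
- move=> i j x; apply: setP => s /=; rewrite (_ : _ \o _ = s) //.
  apply: functional_extensionality_dep => k /=; congr s; rewrite /transposition.
  case: (k =P i) => [->|ki].
    by rewrite eqxx; case: eqP.
  by case: (k =P j) => [->|kj]; rewrite ?eqxx //; case: eqP => //; case: eqP.
- move=> i j k x ij ik jk; apply: setP => s /=.
  rewrite (_ : _ \o _ \o _ = (s \o transposition j k) \o transposition i j) //.
  apply: functional_extensionality_dep => l /=; congr s; rewrite /transposition.
  by do ![case: eqP => //=]; congruence.
- move=> i j x; apply: setP => s /=.
  rewrite (_ : _ \o _ = s \o replacement i j) //.
  apply: functional_extensionality_dep => l /=; congr s.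
  by rewrite /replacement /transposition; do ![case: eqP => //=]; congruence.
- move=> i j; apply: setP => s /=; split=> // _.
  by rewrite /replacement eqxx; case: eqP.
- move=> i j x; apply: setP => s /=; split=> [[[xs e]|//]|]; last by right.
  rewrite (_ : s \o _ = s) //; apply: functional_extensionality_dep => k /=.
  by rewrite /replacement; case: eqP => // ->.
Qed.

(** A subalgebra of one full set algebra is a subdirect product with a single
    factor. *)
Lemma RQEA_embedding (I : eqType) (U : Type) (A : algebra I)
    (f : A -> full_set_alg I U) :
  is_embedding A (full_set_alg I U) f -> RQEA A.
Proof.
move=> [fh fI]; pose S := range_subalgebra fh.
pose C (_ : unit) : algebra I := alg_of S.
have fS x : universe S (f x) by exists x.
pose g x : prod_alg C := fun _ => exist _ (f x) (fS x).
have [gh gI] := corestrict_embedding fS (conj fh fI).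
have ge : is_embedding A (prod_alg C) g.
  split; last by move=> x y /(congr1 (fun z => z tt)) /gI.
  exact: pairing_hom.
pose P := range_subalgebra ge.1.
exists unit, (fun=> U), (fun=> S), P; split.
  case=> -[y yS]; have [x _ fx] := yS; exists (g x); first by exists x.
  exact: eq_exist.
exists (fun x => exist _ (g x) (imageT g x)).
have [] // := inj_surj_iso (corestrict_embedding (S := P) (imageT g) ge).
by move=> [y yP]; have [x _ gx] := yP; exists x; apply: eq_exist.
Qed.

Lemma RQEA_isomorphic (I : eqType) (A B : algebra I) :
  isomorphic B A -> RQEA A -> RQEA B.
Proof.
move=> [f [fh fb]] [K [U [S [P [Psub [g [gh gb]]]]]]].
exists K, U, S, P; split=> //; exists (g \o f).
by split; [exact: comp_hom | exact: bij_comp].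
Qed.

Lemma kernel_ideal (I : eqType) (U : Type) (B : algebra I)
    (f : B -> full_set_alg I U) :
  is_hom B (full_set_alg I U) f -> is_ideal B [set x | f x = 0].
Proof.
move=> [fD fM fN f0 f1 fc fs fp fd]; split=> //=.
- by move=> x y fx fy; rewrite fD fx fy; apply: setU0.
- by move=> x y xy fy; have := fD x y; rewrite xy fy /= setU0.
- by move=> i x fx; rewrite fc fx; apply/seteqP; split=> // s [].
Qed.

(** * Dilations *)

(** The codomain [D] of a neat embedding can always be cut down to the subalgebra
    generated by the image, which still contains [A] neatly. *)
Lemma generated_dilation (alpha : Ord) (D : QEA (ord_add alpha omega))
    (A : algebra alpha) (e : A -> Rd D) :
  is_embedding A (Rd D) e -> (forall a, Nr_universe (e a : D)) ->
  exists (B : QEA (ord_add alpha omega)) (incl : B -> D) (eB : A -> Rd B),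
    [/\ is_embedding B D incl, is_embedding A (Rd B) eB,
        forall a, Nr_universe (eB a : B), Sg B (range eB) = [set: B] &
        forall a, incl (eB a) = e a].
Proof.
move=> [eh eI] eN; pose S := Subalgebra (Sg_closed (range (e : A -> D))).
have vE := sval_embedding S.
have eS a : universe S (e a) by move=> T [_]; apply; exists a.
pose B := MkQEA (is_QEA_embedding vE (QEA_axioms D)).
pose eB a : Rd B := exist _ (e a : D) (eS a).
exists B, sval, eB; split=> //.
- have vI := vE.2; case: eh => eD eM eN' e0 e1 ec es ep ed.
  split; last by move=> x y [] /eI.
  by split; repeat intro; apply: vI => /=;
    rewrite ?(eD, eM, eN', e0, e1, ec, es, ep, ed).
- by move=> a k; apply: vE.2; apply: eN.
- apply/seteqP; split=> // b _ T [Tc TeB].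
  have [] := svalP b (sval @` T); last by move=> b' Tb' /vE.2 <-.
  split; first exact: image_closed vE.1 Tc.
  by move=> _ [a _ <-]; exists (eB a) => //; apply: TeB; exists a.
Qed.

(** In a set algebra, if [z] does not depend on the coordinate [k], then [s]
    satisfies this term when [z] holds of [s], and some value different from
    [s i0] can replace [s i0] in [s] so that [z] still holds, but can replace
    neither [s i1] nor [s i2] in that way. *)
Definition exchange (J : Type) (A : algebra J) (i0 i1 i2 k : J) (z : A) : A :=
  cyl k (z * sub i0 k z * - diag A i0 k * - sub i1 k z * - sub i2 k z).

Lemma exchange_hom (J : Type) (A B : algebra J) (f : A -> B) i0 i1 i2 k z :
  is_hom A B f ->
  f (exchange i0 i1 i2 k z) = exchange i0 i1 i2 k (f z).
Proof.
move=> [fD fM fN f0 f1 fc fs fp fd].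
by rewrite /exchange fc !fM !fN !fs fd.
Qed.

Section Dilate.
Variables (alpha : Ord) (U : Type).
Let beta := ord_add alpha omega.

Definition full_QEA (I : eqType) : QEA I := MkQEA (is_QEA_full I U).

Definition dilate (X : full_set_alg alpha U) : Rd (full_QEA beta) :=
  [set s : beta -> U | X (s \o inl)].

Definition upd (s : alpha -> U) (i : alpha) (u : U) (j : alpha) : U :=
  if j == i then u else s j.

Lemma dilate_embedding (u : U) :
  is_embedding (full_set_alg alpha U) (Rd (full_QEA beta)) dilate.
Proof.
split.
  split=> //.
  - move=> i X; apply/seteqP; split=> s /= -[z Xz e].
      exists (fun b : beta => if b is inl j then z j else s b) => // -[j|//] ji.
      by apply: e => ij; apply: ji; rewrite ij.
    by exists (z \o inl) => // j ji; apply: e => -[].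
  - move=> i j X; apply/seteqP; split=> s; rewrite /dilate /=;
    by congr X; apply: functional_extensionality_dep => k;
      rewrite /= /replacement; have [->|ki] := eqVneq k i; rewrite ?eqxx //;
      rewrite ifN_eq.
  - move=> i j X; apply/seteqP; split=> s; rewrite /dilate /=;
    by congr X; apply: functional_extensionality_dep => k;
      rewrite /= /transposition; do ![case: eqP => //=]; congruence.
move=> X Y XY; apply/seteqP; split=> s Xs.
  pose t (b : beta) := if b is inl j then s j else u.
  by have : dilate X t by []; rewrite XY.
pose t (b : beta) := if b is inl j then s j else u.
by have : dilate Y t by []; rewrite -XY.
Qed.

Lemma dilate_Nr X : Nr_universe (dilate X : full_QEA beta).
Proof.
move=> k; apply/seteqP; split=> s /=; last by exists s.
move=> [z Xz e]; rewrite /dilate /= (_ : s \o _ = z \o inl) //.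
by apply: functional_extensionality_dep => j; apply: e.
Qed.

Definition exchange_set (i0 i1 i2 : alpha) (X : set (alpha -> U)) :
    full_set_alg alpha U :=
  [set s | exists u, [/\ X s, X (upd s i0 u), s i0 <> u,
                         ~ X (upd s i1 u) & ~ X (upd s i2 u)]].

(** The spare index [inr 0] only serves as a quantified variable, so the value is
    again a cylinder over a set of dimension [alpha]. *)
Lemma exchange_dilate i0 i1 i2 X :
  exchange (inl i0) (inl i1) (inl i2) (inr 0%N) (dilate X : full_QEA beta) =
  dilate (exchange_set i0 i1 i2 X).
Proof.
have updE s i :
    (s \o replacement (inl i : beta) (inr 0%N)) \o inl =
    upd (s \o inl) i (s (inr 0%N)).
  by apply: functional_extensionality_dep => j /=; rewrite /replacement /upd;
    do ![case: eqP => //=]; congruence.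
apply/seteqP; split=> s.
  move=> [z [[[[Xz Xi0] di0] Xi1] Xi2] e].
  have sz : s \o inl = z \o inl.
    by apply: functional_extensionality_dep => j; apply: e.
  exists (z (inr 0%N)); rewrite sz; move: Xi0 Xi1 Xi2.
  by rewrite /= /dilate /= !updE.
move=> [u [Xs Xi0 di0 Xi1 Xi2]].
pose z b := if b == inr 0%N :> beta then u else s b.
have zs : z \o inl = s \o inl by apply: functional_extensionality_dep.
have zu : z (inr 0%N) = u by rewrite /z eqxx.
exists z; last by move=> b; rewrite /z; case: eqP.
by rewrite /= /dilate /= !updE zu zs; do !split=> //.
Qed.

End Dilate.

End Algebras.

(** * Bisimilar sequences *)

Section MaxParity.
Variable alpha : Ord.
Let point := (alpha -> (alpha + nat))%type.

Definition hits (s : point) (m : nat) := exists i, s i = inr m.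

(** Boundedness stands for finiteness of the set of numbers hit. It is what is
    needed to find a number beyond them, and it is stable under changes of one
    coordinate. *)
Definition bounded (s : point) := exists b, forall m, hits s m -> m <= b.

Definition is_max (s : point) (m : nat) :=
  hits s m /\ forall n, hits s n -> n <= m.

(** With [b = false] the maximum must be even; with [b = true] its parity must
    record whether [0] is hit. *)
Definition max_parity (b : bool) (s : point) :=
  injective s /\ exists2 m, is_max s m & odd m = b && `[< hits s 0 >].

Definition kernel_eq (s t : point) := forall i j, s i = s j <-> t i = t j.

Definition agree_off (i : alpha) (s t : point) := forall j, j <> i -> s j = t j.

(** Unbounded sequences satisfy neither relation and stay unbounded under changes
    of one coordinate, so they can be matched with themselves. A bounded sequence
    is matched with every bounded sequence that has the same repetitions and the
    same status, whatever numbers the two hit. *)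
Record bisim (b : bool) (s t : point) : Prop := Bisim {
  bisim_kernel : kernel_eq s t;
  bisim_bounded : bounded s <-> bounded t;
  bisim_unbounded : ~ bounded s -> s = t;
  bisim_max_parity : max_parity b s <-> max_parity (~~ b) t }.

Lemma bisim_sym b s t : bisim b s t -> bisim (~~ b) t s.
Proof.
move=> [ker bd ubd mp]; split=> //; rewrite ?negbK.
- by move=> i j; have := ker i j; tauto.
- tauto.
- by move=> nt; apply/esym/ubd; tauto.
- tauto.
Qed.

Lemma is_max_uniq s m n : is_max s m -> is_max s n -> m = n.
Proof.
move=> [hm mmax] [hn nmax].
by apply/eqP; rewrite eqn_leq nmax //= mmax.
Qed.

Lemma max_parity_bounded b s : max_parity b s -> bounded s.
Proof. by move=> [_ [m [_ m_max] _]]; exists m. Qed.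

Lemma bisim_trivial b s : ~ injective s \/ ~ bounded s -> bisim b s s.
Proof.
have mp0 c : ~ injective s \/ ~ bounded s -> ~ max_parity c s.
  by move=> [|] h mp; apply: h; [case: mp | apply: max_parity_bounded mp].
by move=> h; split=> //; split=> /mp0; case.
Qed.

Lemma bounded_agree_off i s t : agree_off i s t -> bounded s -> bounded t.
Proof.
move=> st [b sb].
exists (maxn b (if t i is inr m then m else 0)) => m [j tj].
have [ji|/eqP ji] := eqVneq j i; first by rewrite -ji tj leq_maxr.
by rewrite leq_max sb //; exists j; rewrite st.
Qed.

Lemma agree_off_sym i s t : agree_off i s t -> agree_off i t s.
Proof. by move=> st j ji; rewrite st. Qed.

Lemma kernel_eq_inj s t : kernel_eq s t -> injective s -> injective t.
Proof. by move=> ker sI i j /ker /sI. Qed.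

Lemma agree_off_upd i (s : point) u : agree_off i s (upd s i u).
Proof. by move=> j ji; rewrite /upd; case: eqP. Qed.

Lemma updE (s : point) i u : upd s i u i = u.
Proof. by rewrite /upd eqxx. Qed.

(** A number [m] beyond all those hit becomes the maximum, and whether [0] is hit
    does not depend on [m], which is positive. So the parity of [m] decides the
    relation. *)
Lemma upd_fresh b (s : point) i (P : Prop) :
  bounded s ->
  exists u, (forall j, s j <> u) /\
    (injective (upd s i u) -> (max_parity b (upd s i u) <-> P)).
Proof.
move=> [n sn].
pose flag := `[< exists2 j, j <> i & s j = inr 0 >].
pose q := (b && flag) == `[< P >].
pose m := n.+1 + (odd n.+1 (+) q).
have m_odd : odd m = q by rewrite oddD oddb addbA addbb.
have nm : n < m by rewrite ltn_addr.
have s_fresh j : s j <> inr m.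
  by move=> sj; have := sn m (ex_intro _ j sj); rewrite leqNgt nm.
exists (inr m); split=> // uI.
have hitsE k : hits (upd s i (inr m)) k <->
    k = m \/ exists2 j, j <> i & s j = inr k.
  split.
    move=> [j]; rewrite /upd; case: eqP => [_ [->]|ji sj]; first by left.
    by right; exists j.
  move=> [->|[j ji sj]]; first by exists i; rewrite updE.
  by exists j; rewrite -agree_off_upd.
have m_max : is_max (upd s i (inr m)) m.
  split=> [|k /hitsE [->//|[j _ sj]]]; first by exists i; rewrite updE.
  by apply: leq_trans (ltnW nm); apply: sn; exists j.
have flagE : `[< hits (upd s i (inr m)) 0 >] = flag.
  apply/asboolP/asboolP; rewrite hitsE; last by right.
  by move=> [m0|//]; move: nm; rewrite -m0.
rewrite /max_parity flagE; split=> [[_ [k k_max]]|p].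
  rewrite (is_max_uniq k_max m_max) m_odd /q.
  by case: asboolP => // _; case: (b && flag).
split=> //; exists m => //; rewrite m_odd /q.
by case: asboolP => // _; case: (b && flag).
Qed.

(** If the new value of [t] at [i] is a repetition, then so must be that of [t'],
    and both relations fail. If not, a large number of suitable parity gives [t']
    the status of [t]. *)
Lemma bisim_zigzag b i s s' t :
  bisim b s s' -> agree_off i s t ->
  exists2 t', agree_off i s' t' & bisim b t t'.
Proof.
move=> [ker bd ubd mp] st.
have [sb|snb] := pselect (bounded s); last first.
  exists t; first by rewrite -ubd.
  by apply: bisim_trivial; right=> /(bounded_agree_off (agree_off_sym st)).
have tb : bounded t := bounded_agree_off st sb.
have s'b : bounded s' by apply/bd.
have bisim_upd u : kernel_eq t (upd s' i u) ->
    (injective (upd s' i u) -> max_parity (~~ b) (upd s' i u) <->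
       max_parity b t) -> bisim b t (upd s' i u).
  move=> tker mpu.
  have ub := bounded_agree_off (@agree_off_upd i s' u) s'b.
  split=> //; split=> h.
    by apply/mpu=> //; apply: kernel_eq_inj tker _; case: h.
  by have [uI _] := h; apply/mpu.
have [[j ji tij]|t_new] := pselect (exists2 j, j <> i & t j = t i).
  have tker : kernel_eq t (upd s' i (s' j)).
    move=> k l; rewrite /upd.
    case: (k =P i) => [->|ki]; case: (l =P i) => [->|li] //.
    - by rewrite -tij -!st.
    - by rewrite -tij -!st.
    - by rewrite -!st.
  exists (upd s' i (s' j)); first exact: agree_off_upd.
  apply: bisim_upd => // uI; case: (ji); apply: uI.
  by rewrite updE -agree_off_upd.
have [u [u_new mpu]] := upd_fresh (~~ b) i (max_parity b t) s'b.
exists (upd s' i u); first exact: agree_off_upd.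
apply: bisim_upd => // k l; rewrite /upd.
case: (k =P i) => [->|ki]; case: (l =P i) => [->|li] //.
- by split=> e; [case: t_new; exists l | case: (u_new l)].
- by split=> e; [case: t_new; exists k | case: (u_new k)].
- by rewrite -!st.
Qed.

(** A sequence with a repetition is bisimilar to itself; every sequence is one
    change of coordinate away from one. *)
Lemma bisim_total (i j : alpha) b s : i <> j -> exists t, bisim b s t.
Proof.
move=> ij; pose s0 := upd s i (s j).
have s0s0 : bisim b s0 s0.
  apply: bisim_trivial; left=> s0I; case: (ij); apply: s0I.
  by rewrite /s0 updE -agree_off_upd // => /esym.
have [t _ ?] := bisim_zigzag s0s0 (agree_off_sym (@agree_off_upd i s (s j))).
by exists t.
Qed.

Lemma transpositionK (i j : alpha) : involutive (transposition i j).
Proof.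
by move=> k; rewrite /transposition; do ![case: eqP => //=]; congruence.
Qed.

Lemma hits_transposition s i j m : hits (s \o transposition i j) m <-> hits s m.
Proof.
split=> [[k sk]|[k sk]]; first by exists (transposition i j k).
by exists (transposition i j k); rewrite /= transpositionK.
Qed.

Lemma max_parity_transposition b s i j :
  max_parity b (s \o transposition i j) <-> max_parity b s.
Proof.
have hE : hits (s \o transposition i j) = hits s.
  by apply: functional_extensionality_dep => m;
    apply/propext/hits_transposition.
rewrite /max_parity /is_max hE.
have invI := inv_inj (@transpositionK i j).
split=> -[sI ?]; split=> //; last exact: inj_comp.
move=> k l skl; apply: invI; apply: sI.
by rewrite /= !transpositionK.
Qed.

Lemma bisim_transposition b s t i j :
  bisim b s t -> bisim b (s \o transposition i j) (t \o transposition i j).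
Proof.
have bE r : bounded (r \o transposition i j) <-> bounded r.
  by split=> -[n rn]; exists n => m rm; apply: rn;
    apply/(hits_transposition r i j).
move=> [ker bd ubd mp]; split.
- by move=> k l; apply: ker.
- by rewrite !bE.
- by rewrite bE => /ubd ->.
- by rewrite !max_parity_transposition.
Qed.

(** After a proper replacement the sequences are not injective, so both relations
    fail. *)
Lemma bisim_replacement b s t i j :
  bisim b s t -> bisim b (s \o replacement i j) (t \o replacement i j).
Proof.
have [->|/eqP ij] := eqVneq i j.
  suff idE r : r \o replacement j j = r :> point by rewrite !idE.
  by apply: functional_extensionality_dep => k /=;
    rewrite replacement_transposition_id.
have off r : agree_off i r (r \o replacement i j).
  by move=> k ki /=; rewrite /replacement; case: eqP.
have mp0 c r : ~ max_parity c (r \o replacement i j).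
  move=> [rI _]; case: ij; apply: rI.
  by rewrite /= /replacement eqxx; case: eqP.
have bE r : bounded (r \o replacement i j) <-> bounded r.
  by split; apply: bounded_agree_off; [apply: agree_off_sym|].
move=> [ker bd ubd mp]; split.
- by move=> k l; apply: ker.
- by rewrite !bE.
- by rewrite bE => /ubd ->.
- by split=> /mp0.
Qed.

(** * The algebra of invariant pairs *)

Definition base_pair : algebra alpha :=
  prod_alg (fun _ : bool => full_set_alg alpha (alpha + nat)).

Definition bisim_invariant : set base_pair :=
  [set X | forall b s t, bisim b s t -> X b s -> X (~~ b) t].

Lemma bisim_invariant_closed : is_subuniverse bisim_invariant.
Proof.
split.
- move=> X Y IX IY b s t st [Xs|Ys]; [left; exact: IX Xs|right; exact: IY Ys].
- by move=> X Y IX IY b s t st [Xs Ys]; split; [exact: IX Xs|exact: IY Ys].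
- move=> X IX b s t st nXs Xt; apply: nXs; rewrite -(negbK b).
  exact: IX (bisim_sym st) Xt.
- by [].
- by [].
- move=> i X IX b s t st [z Xz sz].
  have [z' tz' zz'] := bisim_zigzag st sz.
  by exists z' => //; apply: IX zz' Xz.
- by move=> i j X IX b s t /(bisim_replacement i j) st; apply: IX.
- by move=> i j X IX b s t /(bisim_transposition i j) st; apply: IX.
- by move=> i j b s t [ker _ _ _] /ker.
Qed.

Definition bisim_subalgebra : subalgebra base_pair :=
  Subalgebra bisim_invariant_closed.

Lemma max_parity_invariant : bisim_invariant max_parity.
Proof. by move=> b s t [_ _ _ mp] /mp. Qed.

Definition component (b : bool) (a : alg_of bisim_subalgebra) :
  full_set_alg alpha (alpha + nat) := sval a b.

(** By totality of [bisim], each component of an invariant pair determines the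
    other. *)
Lemma component_embedding (i j : alpha) (b : bool) :
  i <> j -> is_embedding (alg_of bisim_subalgebra) _ (component b).
Proof.
move=> ij; split.
  exact: comp_hom (sval_embedding _).1 (proj_hom _ b).
move=> [X IX] [Y IY]; rewrite /component /= => XY; apply: eq_exist.
have notb (Z Z' : base_pair) : bisim_invariant Z -> bisim_invariant Z' ->
    Z b = Z' b -> Z (~~ b) `<=` Z' (~~ b).
  move=> IZ IZ' ZZ' s Zs; have [t st] := bisim_total (~~ b) s ij.
  have := IZ _ _ _ st Zs; rewrite negbK ZZ' -{1}(negbK b) => Z't.
  by have := IZ' _ _ _ (bisim_sym st); rewrite !negbK; apply;
    move: Z't; rewrite negbK.
apply: functional_extensionality_dep => c.
have [->//|/negPf cb] := eqVneq c b.
have -> : c = ~~ b by move: cb; case: (c); case: (b).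
by apply/seteqP; split; apply: notb.
Qed.

(** * What one more value reveals *)

(** The coordinate [im] that holds the maximum [m] of [s] cannot be both [i1] and
    [i2]. Say [im <> i1]: then [m] survives in [upd s i1 u], whose maximum is thus
    [m], even since [s] satisfies the relation, or a larger [u], which is then also
    the maximum of [upd s i0 u], so even. *)
Lemma exchange_set_max_eq0 (i0 i1 i2 : alpha) :
  i1 <> i2 -> exchange_set i0 i1 i2 (max_parity false) = set0.
Proof.
move=> i12; apply/seteqP; split=> // s [u [[sI smax] [vI vmax] s0u no1 no2]].
have u_new j : s j <> u.
  move=> sj; have [ji|/eqP ji] := eqVneq j i0; first by rewrite -ji in s0u.
  by apply: (ji); apply: vI; rewrite updE -agree_off_upd.
have [m [[im sim] m_max] m_even] := smax.
have parity_upd i : im <> i -> max_parity false (upd s i u).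
  move=> imi; split.
    move=> k l; rewrite /upd; case: (k =P i) => [->|_]; case: (l =P i) => // _.
    - by move=> /esym /u_new.
    - by move=> /u_new.
    - exact: sI.
  have him : hits (upd s i u) m by exists im; rewrite -agree_off_upd.
  have hupd n k : hits (upd s k u) n -> u = inr n \/ n <= m.
    move=> [j]; rewrite /upd; case: eqP => [_|_ sj]; first by left.
    by right; apply: m_max; exists j.
  have [[n un mn]|nbig] := pselect (exists2 n, u = inr n & m <= n).
    exists n.
      split; first by exists i; rewrite updE.
      by move=> l /hupd; rewrite un => -[[->//]|/leq_trans ->].
    have [n' n'_max n'_even] := vmax; rewrite -[RHS]n'_even; congr odd.
    apply: is_max_uniq n'_max.
    split; first by exists i0; rewrite updE.
    by move=> l /hupd; rewrite un => -[[->//]|/leq_trans ->].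
  exists m => //; split=> // l /hupd [ul|//].
  by rewrite leqNgt; apply/negP => ml; case: nbig; exists l => //; apply: ltnW.
have [imi1|/eqP imi1] := eqVneq im i1; last exact/no1/parity_upd.
by apply/no2/parity_upd; rewrite imi1.
Qed.

(** The values are [0] at [i0], [1] at [i3] and [u = 2]. The numbers hit are
    [0] and [1] in [s], [1] and [2] once [u] replaces [0], so the relation holds;
    they are [0], [1] and [2] when [u] replaces a value in [alpha], and it fails. *)
Lemma exchange_set_flagged_max_neq0 (i0 i1 i2 i3 : alpha) :
  i0 <> i1 -> i0 <> i2 -> i3 <> i0 -> i3 <> i1 -> i3 <> i2 ->
  exchange_set i0 i1 i2 (max_parity true) <> set0.
Proof.
move=> i01 i02 i30 i31 i32 e.
pose s : point := fun j => if j == i0 then inr 0 else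
                           if j == i3 then inr 1 else inl j.
suff : exchange_set i0 i1 i2 (max_parity true) s by rewrite e.
have s0 : s i0 = inr 0 by rewrite /s eqxx.
have s3 : s i3 = inr 1 by rewrite /s eqxx; case: eqP.
have hs m : hits s m -> m <= 1.
  by move=> [j]; rewrite /s; do ![case: eqP => _] => // -[<-].
have hitT r i m : r i = inr m -> `[< hits r m >].
  by move=> ri; apply/asboolP; exists i.
have no i : i0 <> i -> i3 <> i -> ~ max_parity true (upd s i (inr 2)).
  move=> i0i i3i [_ [m m_max]].
  rewrite (hitT _ i0); last by rewrite -agree_off_upd.
  rewrite (is_max_uniq m_max (n := 2)) //.
  split; first by exists i; rewrite updE.
  move=> n [j]; rewrite /upd; case: eqP => [_ [<-]//|_ sj].
  by rewrite (leq_trans (hs n _)) //; exists j.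
have sI : injective s.
  move=> j k; rewrite /s; do ![case: eqP => [->|?]] => //; congruence.
exists (inr 2); split; try by apply: no.
- split=> //; exists 1; last by rewrite (hitT _ i0).
  by split=> //; exists i3.
- split.
    by move=> j k; rewrite /upd /s; do ![case: eqP => [->|?]] => //; congruence.
  exists 2.
    split; first by exists i0; rewrite updE.
    move=> n [j]; rewrite /upd; case: eqP => [_ [<-]//|_ sj].
    by rewrite (leq_trans (hs n _)) //; exists j.
  case: asboolP => // -[j]; rewrite /upd /s.
  by do ![case: eqP => // _].
- by rewrite s0.
Qed.

End MaxParity.

(** * The counterexample *)

Lemma omega_injection (alpha : Ord) :
  ord_le omega alpha -> exists f : nat -> alpha, injective f.
Proof.
move=> [f [fmono _]]; exists f => m n fmn; apply/eqP.
rewrite eqn_leq; have := fmono m n; have := fmono n m.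
by rewrite fmn (fmono n n) /= leqnn => <- <-.
Qed.

Section Counterexample.
Variables (alpha : Ord) (f : nat -> alpha).
Hypothesis f_inj : injective f.

Let beta := ord_add alpha omega.
Let U := (alpha + nat)%type.
Let A := alg_of (bisim_subalgebra alpha).
Let C : QEA beta := full_QEA U beta.
Let parities : A := exist _ _ (@max_parity_invariant alpha).

Let f_neq m n : m != n -> f m <> f n.
Proof. by move=> /eqP mn /f_inj. Qed.

Definition separator (B : QEA beta) (z : B) : B :=
  exchange (inl (f 0)) (inl (f 1)) (inl (f 2)) (inr 0) z.

Lemma separator_hom (B B' : QEA beta) (h : B -> B') (z : B) :
  is_hom B B' h -> h (separator z) = separator (h z).
Proof. exact: exchange_hom. Qed.

Definition dilate_component (b : bool) (a : A) : Rd C := dilate (component b a).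

Lemma dilate_component_embedding b : is_embedding A (Rd C) (dilate_component b).
Proof.
have fE := component_embedding b (f_neq (isT : 0 != 1)).
exact: comp_embedding fE (dilate_embedding alpha (inr 0 : U)).
Qed.

Lemma RQEA_bisim_algebra : RQEA A.
Proof.
exact: RQEA_embedding (component_embedding false (f_neq (isT : 0 != 1))).
Qed.

Lemma separator_dilate b :
  separator (dilate_component b parities : C) =
  dilate (exchange_set (f 0) (f 1) (f 2) (max_parity b)).
Proof. exact: exchange_dilate. Qed.

Lemma separator_false : separator (dilate_component false parities : C) = azero.
Proof.
rewrite separator_dilate exchange_set_max_eq0; last exact: f_neq.
by apply/seteqP; split.
Qed.

Lemma separator_true : separator (dilate_component true parities : C) <> azero.
Proof.
rewrite separator_dilate -(hom_zero (dilate_embedding alpha (inr 0 : U)).1).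
move/(dilate_embedding alpha (inr 0 : U)).2.
by apply: (@exchange_set_flagged_max_neq0 _ _ _ _ (f 3)); apply: f_neq.
Qed.

Lemma dilations_not_isomorphic :
  exists (A A' : algebra alpha) (B B' : QEA (ord_add alpha omega))
     (eA : A -> alg_of (Nr B)) (eA' : A' -> alg_of (Nr B')) (i : A -> A'),
     [/\ RQEA A /\ RQEA A',
         is_embedding A (alg_of (Nr B)) eA /\
         is_embedding A' (alg_of (Nr B')) eA',
         Sg B (range (fun a => sval (eA a))) = [set: B] /\
         Sg B' (range (fun a => sval (eA' a))) = [set: B'],
         is_iso A A' i &
         ~ exists ibar : B -> B',
             is_iso B B' ibar /\
             forall a : A, ibar (sval (eA a)) = sval (eA' (i a))].
Proof.
have dil b := generated_dilation (dilate_component_embedding b)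
  (fun a => @dilate_Nr alpha U (component b a)).
have [B [p [e [[ph pI] eE eN eSg pe]]]] := dil false.
have [B' [p' [e' [[p'h _] e'E e'N e'Sg p'e]]]] := dil true.
exists A, A, B, B', (fun a => exist _ (e a) (eN a)),
  (fun a => exist _ (e' a) (e'N a)), id.
split; first by split; apply: RQEA_bisim_algebra.
- by split; apply: corestrict_embedding.
- by [].
- by split; [split | exists id].
move=> [h [[hh _] he]]; apply: separator_true.
have e0 : separator (e parities : B) = azero.
  apply: pI; rewrite (hom_zero ph) (separator_hom _ ph).
  by rewrite pe separator_false.
have := separator_hom (e parities) hh.
rewrite e0 (hom_zero hh) [h _]he /= => /(congr1 p').
by rewrite (hom_zero p'h) (separator_hom _ p'h) [p' _]p'e => <-.
Qed.

Let D : QEA beta := MkQEA (is_QEA_prod (fun _ : bool => QEA_axioms C)).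

(** [S] is the copy of the algebra of invariant pairs, and [y] is the value of the
    term at the pair of relations, with components [0] and not [0]. *)
Lemma dilation_with_new_element :
  exists (B : QEA beta) (S : subalgebra (Rd B)) (p : bool -> B -> C) (y : B),
    [/\ RQEA (alg_of S), universe S `<=` universe (Nr B),
        Sg B (universe S) = [set: B], forall b, is_hom B C (p b) &
        [/\ universe (Nr B) y, p false y = azero, p true y <> azero &
            forall a, universe S a -> p false a = azero -> p true a = azero]].
Proof.
have eE : is_embedding A (Rd D) (fun a b => dilate_component b a).
  split.
    exact: (pairing_hom (B := fun _ : bool => Rd C) (f := dilate_component)
      (fun b => (dilate_component_embedding b).1)).
  move=> x y /(congr1 (fun z => z false)).
  exact: (dilate_component_embedding false).2.
have eN a : Nr_universe ((fun b => dilate_component b a) : D).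
  by move=> k; apply: functional_extensionality_dep => b; apply: dilate_Nr.
have [B [p [e [[ph pI] [eh eI] Ne eSg pe]]]] := generated_dilation eE eN.
have qh b : is_hom B C (fun x => p x b) := comp_hom ph (proj_hom _ b).
have qsep b : p (separator (e parities)) b =
    separator (dilate_component b parities : C).
  by rewrite (separator_hom _ (qh b)) pe.
exists B, (range_subalgebra eh), (fun b x => p x b), (separator (e parities)).
split=> //.
- apply: RQEA_isomorphic RQEA_bisim_algebra.
  have eS x : universe (range_subalgebra eh) (e x) by exists x.
  have [|_ //] := inj_surj_iso (corestrict_embedding eS (conj eh eI)).
  by move=> [y yS]; have [x _ ex] := yS; exists x; apply: eq_exist.
- by move=> _ [a _ <-]; apply: Ne.
split.
- move=> k; apply: pI; rewrite (hom_cyl ph).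
  apply: functional_extensionality_dep => b.
  rewrite -[LHS]/(cyl _ (p _ b)) qsep separator_dilate; exact: dilate_Nr.
- by rewrite qsep separator_false.
- by rewrite qsep; apply: separator_true.
- move=> _ [a _ <-]; rewrite !pe.
  have [h0 inj0] := dilate_component_embedding false.
  move=> a0; have -> : a = azero.
    by apply: inj0; rewrite (hom_zero h0); apply: a0.
  exact: hom_zero (dilate_component_embedding true).1.
Qed.

Lemma generators_neq_neat_reduct :
  exists (B : QEA (ord_add alpha omega)) (A : subalgebra (Rd B)),
     [/\ RQEA (alg_of A), universe A `<=` universe (Nr B),
         Sg B (universe A) = [set: B] & universe A <> universe (Nr B)].
Proof.
have [B [S [p [y [RS SN SgS _ [Ny y0 y1 Sp]]]]]] := dilation_with_new_element.
by exists B, S; split=> // SNr; apply: y1; apply: Sp; rewrite ?SNr.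
Qed.

Lemma ideal_not_generated_below :
  exists (B : QEA (ord_add alpha omega)) (A : subalgebra (Rd B)) (J : set B),
     [/\ RQEA (alg_of A), universe A `<=` universe (Nr B),
         Sg B (universe A) = [set: B], is_ideal B J &
         Ig B (J `&` universe A) <> J].
Proof.
have [B [S [p [y [RS SN SgS ph [Ny y0 y1 Sp]]]]]] := dilation_with_new_element.
exists B, S, [set x | p false x = azero]; split=> //; first exact: kernel_ideal.
move=> IgE; apply: y1.
have : Ig B ([set x | p false x = azero] `&` universe S) y by rewrite IgE.
move=> Igy; apply: (Igy [set x | p true x = azero]).
split; first exact: kernel_ideal (ph true).
by move=> a [a0 Sa]; apply: Sp.
Qed.

End Counterexample.

Theorem theorem33 (alpha : Ord) (alpha_ge_omega : ord_le omega alpha) :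
  (exists (B : QEA (ord_add alpha omega)) (A : subalgebra (Rd B)),
     [/\ RQEA (alg_of A), universe A `<=` universe (Nr B),
         Sg B (universe A) = [set: B] & universe A <> universe (Nr B)])
  /\
  (exists (B : QEA (ord_add alpha omega)) (A : subalgebra (Rd B)) (J : set B),
     [/\ RQEA (alg_of A), universe A `<=` universe (Nr B),
         Sg B (universe A) = [set: B], is_ideal B J &
         Ig B (J `&` universe A) <> J])
  /\
  (exists (A A' : algebra alpha) (B B' : QEA (ord_add alpha omega))
     (eA : A -> alg_of (Nr B)) (eA' : A' -> alg_of (Nr B')) (i : A -> A'),
     [/\ RQEA A /\ RQEA A',
         is_embedding A (alg_of (Nr B)) eA /\
         is_embedding A' (alg_of (Nr B')) eA',
         Sg B (range (fun a => sval (eA a))) = [set: B] /\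
         Sg B' (range (fun a => sval (eA' a))) = [set: B'],
         is_iso A A' i &
         ~ exists ibar : B -> B',
             is_iso B B' ibar /\
             forall a : A, ibar (sval (eA a)) = sval (eA' (i a))]).
Proof.
have [f f_inj] := omega_injection alpha_ge_omega.
split; first exact: generators_neq_neat_reduct f_inj.
split; first exact: ideal_not_generated_below f_inj.
exact: dilations_not_isomorphic f_inj.
Qed.
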